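(* Let $\mathsf{K}$ be a prevariety of (generalized) quantales and $\mathbf{M}$ a pomonoid, and suppose that the unit map $\eta_M\colon M\to F_{\mathsf{K}}(M)$ is an order-embedding. Then the forgetful functor (sending an $F_{\mathsf{K}}(\mathbf{M})$-module with action $\ast$ to the $\mathbf{M}$-act with action $a\star x=\eta_M(a)\ast x$, and acting as the identity on morphisms) is an isomorphism between the category of $F_{\mathsf{K}}(\mathbf{M})$-modules whose underlying (generalized) quantale lies in $\mathsf{K}$ and the category of $\mathbf{M}$-acts whose underlying (generalized) quantale lies in $\mathsf{K}$. In particular, each such $\mathbf{M}$-act can be uniquely expanded to an $F_{\mathsf{K}}(\mathbf{M})$-module.
   Context: Fix one of two parallel settings: plain (''joins'' = joins of arbitrary families) or generalized (''joins'' = joins of non-empty families). A (generalized) quantale is $\mathbf{Q}=\langle Q,\bigvee,+,\mathsf{0}\rangle$ with $Q$ a poset having all such joins, $\langle Q,+,\mathsf{0}\rangle$ a monoid with $+$ order-preserving and distributing over such joins on both sides; homomorphisms preserve such joins, $+$, $\mathsf{0}$. A (generalized) quantale term is a formal join of a (non-empty, in the generalized setting) set of terms built from variables, $+$ and $\mathsf{0}$. A prevariety is a class closed under isomorphic images, subalgebras and products. A pomonoid $\mathbf{M}$ is a monoid with a partial order making multiplication order-preserving. For a poset $X$, the $\mathsf{K}$-free (generalized) quantale $F_{\mathsf{K}}(X)\in\mathsf{K}$ comes with an order-preserving $\eta_X\colon X\to F_{\mathsf{K}}(X)$ such that each order-preserving $g\colon X\to\mathbf{Q}\in\mathsf{K}$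 equals $g^\sharp\circ\eta_X$ for a unique homomorphism $g^\sharp$. For the poset reduct $M$ of $\mathbf{M}$, $F_{\mathsf{K}}(M)$ carries a unique binary operation $\cdot$ such that for all terms $t$, all $\bar a, b\in F_{\mathsf{K}}(M)$, and $a,c\in M$: $t(\bar a)\cdot b=t(\bar a\cdot b)$, $\eta_M(a)\cdot t(\bar b)=t(\eta_M(a)\cdot\bar b)$, $\eta_M(a)\cdot\eta_M(c)=\eta_M(ac)$; with unit $\eta_M(1)$, and with $\mathbf{A}_{\mathrm{d}}:=\mathbf{M}$, $\iota:=\eta_M$, this yields the (generalized) additive quantale with multiplication $F_{\mathsf{K}}(\mathbf{M})=\langle\mathbf{M},F_{\mathsf{K}}(M),\eta_M\rangle$. For such a triple $\langle\mathbf{A}_{\mathrm d},\mathbf{A},\iota\rangle$, an $\mathbf{A}$-module is a (generalized) quantale $\mathbf{Q}$ with a map $\ast\colon A\times Q\to Q$, order-preserving in both coordinates, with $(a\cdot b)\ast x=a\ast(b\ast x)$, $\mathsf{1}\ast x=x$, $(a+b)\ast x=a\ast x+b\ast x$, $\mathsf{0}\ast x=\mathsf{0}$, $(\bigvee_i a_i)\ast x=\bigvee_i(a_i\ast x)$, and for $d\in\mathbf{A}_{\mathrm d}$ the map $x\mapsto\iota(d)\ast x$ preserves $+$, $\mathsf{0}$ and joins; module homomorphisms are quantale homomorphisms $f$ with $f(a\ast x)=a\ast f(x)$. An $\mathbf{M}$-act is a (generalized) quantale $\mathbf{L}$ with an action $\ast\colon M\times L\to L$, order-preserving in both coordinates,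 with $(ab)\ast x=a\ast(b\ast x)$, $1\ast x=x$, and each $x\mapsto a\ast x$ a (generalized) quantale endomorphism; morphisms are quantale homomorphisms commuting with the action. *)

(* Defs.v *)
From Stdlib Require Import Relations.
From Stdlib Require Import FunctionalExtensionality ProofIrrelevance ClassicalEpsilon.

Set Implicit Arguments.
Unset Strict Implicit.
Unset Printing Implicit Defensive.

Record poset := Poset {
  pcar :> Type;
  ple : relation pcar;
  ple_order : order pcar ple
}.

Definition order_preserving (X Y : poset) (f : X -> Y) : Prop :=
  forall x y : X, ple x y -> ple (f x) (f y).

Definition order_embedding (X Y : poset) (f : X -> Y) : Prop :=
  forall x y : X, ple x y <-> ple (f x) (f y).

Record pomonoid := Pomonoid {
  pm_poset :> poset;
  pm_mul : pm_poset -> pm_poset -> pm_poset;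
  pm_one : pm_poset;
  pm_mulA : forall a b c, pm_mul a (pm_mul b c) = pm_mul (pm_mul a b) c;
  pm_mul1l : forall a, pm_mul pm_one a = a;
  pm_mul1r : forall a, pm_mul a pm_one = a;
  pm_mul_mono : forall a a' b b',
    ple a a' -> ple b b' -> ple (pm_mul a b) (pm_mul a' b')
}.

Inductive setting := plain | generalized.

Definition admissible (s : setting) (X : Type) (S : X -> Prop) : Prop :=
  match s with plain => True | generalized => exists x, S x end.

(* The sets whose joins are considered: all sets in the plain setting, the
   non-empty ones in the generalized setting. *)
Record jset (s : setting) (X : Type) := JSet {
  jmem :> X -> Prop;
  jmem_adm : admissible s jmem
}.

Lemma admissible_image s X Y (f : X -> Y) (S : X -> Prop) :
  admissible s S -> admissible s (fun y => exists x, S x /\ y = f x).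
Proof.
destruct s; simpl; [trivial|].
intros [x Sx]. exists (f x). exists x. split; trivial.
Qed.

Definition jimage s X Y (f : X -> Y) (S : jset s X) : jset s Y :=
  JSet (admissible_image f (jmem_adm S)).

Definition is_lub (X : poset) (S : X -> Prop) (j : X) : Prop :=
  (forall x, S x -> ple x j) /\ (forall u, (forall x, S x -> ple x u) -> ple j u).

Record quantale (s : setting) := Quantale {
  q_poset :> poset;
  join : jset s q_poset -> q_poset;
  plus : q_poset -> q_poset -> q_poset;
  zero : q_poset;
  join_lub : forall S : jset s q_poset, is_lub S (join S);
  plusA : forall x y z, plus x (plus y z) = plus (plus x y) z;
  plus0l : forall x, plus zero x = x;
  plus0r : forall x, plus x zero = x;
  plus_mono : forall x x' y y',
    ple x x' -> ple y y' -> ple (plus x y) (plus x' y');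
  plus_joinl : forall (S : jset s q_poset) y,
    plus (join S) y = join (jimage (fun x => plus x y) S);
  plus_joinr : forall x (S : jset s q_poset),
    plus x (join S) = join (jimage (fun y => plus x y) S)
}.

Arguments zero {s} q.

Record is_qhom (s : setting) (P Q : quantale s) (f : P -> Q) : Prop := IsQHom {
  qhom_join : forall S : jset s P, f (join S) = join (jimage f S);
  qhom_plus : forall x y, f (plus x y) = plus (f x) (f y);
  qhom_zero : f (zero P) = zero Q
}.

Lemma ple_refl (X : poset) (x : X) : ple x x.
Proof. apply (ord_refl _ _ (ple_order X)). Qed.

Lemma ple_trans (X : poset) (x y z : X) : ple x y -> ple y z -> ple x z.
Proof. apply (ord_trans _ _ (ple_order X)). Qed.

Lemma ple_anti (X : poset) (x y : X) : ple x y -> ple y x -> x = y.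
Proof. apply (ord_antisym _ _ (ple_order X)). Qed.

Lemma is_lub_unique (X : poset) (S T : X -> Prop) j k :
  (forall x, S x <-> T x) -> is_lub S j -> is_lub T k -> j = k.
Proof.
intros E [u1 l1] [u2 l2]. apply ple_anti.
- apply l1. intros x Sx. apply u2, E, Sx.
- apply l2. intros x Tx. apply u1, E, Tx.
Qed.

Lemma join_unique s (Q : quantale s) (S : jset s Q) j : is_lub S j -> join S = j.
Proof. intros H. apply (is_lub_unique (S := S) (T := S)); [tauto | apply join_lub | exact H]. Qed.

Lemma join_ext s (Q : quantale s) (S T : jset s Q) :
  (forall x, S x <-> T x) -> join S = join T.
Proof. intros E. apply (is_lub_unique E); apply join_lub. Qed.

Lemma join_jimage_comp s X Y (Q : quantale s) (f : X -> Y) (g : Y -> Q)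
    (h : X -> Q) (S : jset s X) :
  (forall x, g (f x) = h x) -> join (jimage g (jimage f S)) = join (jimage h S).
Proof.
intros E. apply join_ext. intros z. simpl. split.
- intros [y [[x [Sx ->]] ->]]. exists x. rewrite E. auto.
- intros [x [Sx ->]]. exists (f x). rewrite E. split; eauto.
Qed.

Lemma is_qhom_id s (Q : quantale s) : is_qhom (fun x : Q => x).
Proof.
split; auto. intros S. apply join_ext. intros x. simpl. split; [eauto|].
intros [y [Sy ->]]. exact Sy.
Qed.

Lemma is_qhom_comp s (P Q R : quantale s) (f : P -> Q) (g : Q -> R) :
  is_qhom f -> is_qhom g -> is_qhom (fun x => g (f x)).
Proof.
intros Hf Hg. split.
- intros S. rewrite (qhom_join Hf), (qhom_join Hg).
  apply join_jimage_comp. reflexivity.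
- intros x y. rewrite (qhom_plus Hf), (qhom_plus Hg). reflexivity.
- rewrite (qhom_zero Hf), (qhom_zero Hg). reflexivity.
Qed.

Record subclosed (s : setting) (Q : quantale s) (B : Q -> Prop) : Prop := SubClosed {
  sub_join : forall S : jset s Q, (forall x, S x -> B x) -> B (join S);
  sub_plus : forall x y, B x -> B y -> B (plus x y);
  sub_zero : B (zero Q)
}.

Lemma sub_order (X : poset) (B : X -> Prop) :
  order {x : X | B x} (fun x y => ple (proj1_sig x) (proj1_sig y)).
Proof.
split.
- intros x. apply ple_refl.
- intros x y z. apply ple_trans.
- intros [x Bx] [y By]; simpl; intros xy yx.
  assert (E : x = y) by (apply ple_anti; assumption).
  subst y. f_equal. apply proof_irrelevance.
Qed.

Definition sub_poset (X : poset) (B : X -> Prop) : poset := Poset (sub_order B).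

Lemma sub_eq (X : poset) (B : X -> Prop) (x y : sub_poset B) :
  proj1_sig x = proj1_sig y -> x = y.
Proof.
intros E. apply (@ple_anti (sub_poset B)); simpl; rewrite E; apply ple_refl.
Qed.

Lemma sub_join_in s (Q : quantale s) (B : Q -> Prop) (HB : subclosed B)
    (S : jset s (sub_poset B)) :
  B (join (jimage (fun x : sub_poset B => proj1_sig x) S)).
Proof. apply (sub_join HB). intros x [[y By] [_ ->]]. exact By. Qed.

Definition subquantale s (Q : quantale s) (B : Q -> Prop) (HB : subclosed B) :
  quantale s.
Proof.
refine (@Quantale s (sub_poset B)
  (fun S => exist B _ (sub_join_in HB S))
  (fun x y => exist B (plus (proj1_sig x) (proj1_sig y))
                (sub_plus HB (proj2_sig x) (proj2_sig y)))
  (exist B (zero Q) (sub_zero HB)) _ _ _ _ _ _ _).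
- intros S. destruct (join_lub (jimage (fun x : sub_poset B => proj1_sig x) S)) as [u l].
  split.
  + intros x Sx. apply u. exists x. auto.
  + intros v Hv. apply l. intros x [y [Sy ->]]. apply (Hv y Sy).
- intros x y z. apply sub_eq; apply plusA.
- intros x. apply sub_eq; apply plus0l.
- intros x. apply sub_eq; apply plus0r.
- intros x x' y y'. apply (plus_mono (q := Q)).
- intros S y. apply sub_eq. simpl. rewrite plus_joinl.
  transitivity (join (jimage (fun x : sub_poset B => plus (proj1_sig x) (proj1_sig y)) S)).
  + apply join_jimage_comp. reflexivity.
  + symmetry. apply join_jimage_comp. reflexivity.
- intros x S. apply sub_eq. simpl. rewrite plus_joinr.
  transitivity (join (jimage (fun y : sub_poset B => plus (proj1_sig x) (proj1_sig y)) S)).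
  + apply join_jimage_comp. reflexivity.
  + symmetry. apply join_jimage_comp. reflexivity.
Defined.

Lemma prod_order (I : Type) (X : I -> poset) :
  order (forall i, X i) (fun x y => forall i, ple (x i) (y i)).
Proof.
split.
- intros x i. apply ple_refl.
- intros x y z xy yz i. apply (ple_trans (xy i) (yz i)).
- intros x y xy yx. apply functional_extensionality_dep. intros i.
  apply ple_anti; auto.
Qed.

Definition prod_poset (I : Type) (X : I -> poset) : poset := Poset (prod_order X).

Definition prodquantale s (I : Type) (Q : I -> quantale s) : quantale s.
Proof.
refine (@Quantale s (prod_poset Q)
  (fun S i => join (jimage (fun x : prod_poset Q => x i) S))
  (fun x y i => plus (x i) (y i))
  (fun i => zero (Q i)) _ _ _ _ _ _ _).
- intros S. split.
  + intros x Sx i. apply (join_lub (jimage (fun x : prod_poset Q => x i) S)).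
    exists x. auto.
  + intros u Hu i. apply (join_lub (jimage (fun x : prod_poset Q => x i) S)).
    intros z [x [Sx ->]]. apply (Hu x Sx).
- intros x y z. apply functional_extensionality_dep. intros i. apply plusA.
- intros x. apply functional_extensionality_dep. intros i. apply plus0l.
- intros x. apply functional_extensionality_dep. intros i. apply plus0r.
- intros x x' y y' Hx Hy i. apply plus_mono; auto.
- intros S y. apply functional_extensionality_dep. intros i. rewrite plus_joinl.
  transitivity (join (jimage (fun x : prod_poset Q => plus (x i) (y i)) S)).
  + apply join_jimage_comp. reflexivity.
  + symmetry. apply join_jimage_comp. reflexivity.
- intros x S. apply functional_extensionality_dep. intros i. rewrite plus_joinr.
  transitivity (join (jimage (fun y : prod_poset Q => plus (x i) (y i)) S)).
  + apply join_jimage_comp. reflexivity.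
  + symmetry. apply join_jimage_comp. reflexivity.
Defined.

Definition qiso s (P Q : quantale s) : Prop :=
  exists (f : P -> Q) (g : Q -> P),
    is_qhom f /\ is_qhom g /\ (forall x, g (f x) = x) /\ (forall y, f (g y) = y).

Record prevariety (s : setting) (K : quantale s -> Prop) : Prop := Prevariety {
  prevar_iso : forall P Q : quantale s, qiso P Q -> K P -> K Q;
  prevar_sub : forall (Q : quantale s) (B : Q -> Prop) (HB : subclosed B),
    K Q -> K (subquantale HB);
  prevar_prod : forall (I : Type) (Q : I -> quantale s),
    (forall i, K (Q i)) -> K (prodquantale Q)
}.

Inductive mterm (V : Type) : Type :=
| MVar : V -> mterm V
| MPlus : mterm V -> mterm V -> mterm V
| MZero : mterm V.

Arguments MZero {V}.

Fixpoint meval s (Q : quantale s) (V : Type) (a : V -> Q) (m : mterm V) : Q :=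
  match m with
  | MVar v => a v
  | MPlus m1 m2 => plus (meval a m1) (meval a m2)
  | MZero => zero Q
  end.

Definition qterm (s : setting) (V : Type) := jset s (mterm V).

Definition qeval s (Q : quantale s) (V : Type) (t : qterm s V) (a : V -> Q) : Q :=
  join (jimage (meval a) t).

(* The triple (A_d, A, iota): right multiplications x |-> x * b are quantale
   homomorphisms for every b, left multiplications only for elements of A_d. *)
Record mult_quantale (s : setting) := MultQuantale {
  mq_d : pomonoid;
  mq_q :> quantale s;
  mq_mul : mq_q -> mq_q -> mq_q;
  mq_one : mq_q;
  mq_iota : mq_d -> mq_q;
  mq_mulA : forall a b c, mq_mul a (mq_mul b c) = mq_mul (mq_mul a b) c;
  mq_mul1l : forall a, mq_mul mq_one a = a;
  mq_mul1r : forall a, mq_mul a mq_one = a;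
  mq_mul_mono : forall a a' b b',
    ple a a' -> ple b b' -> ple (mq_mul a b) (mq_mul a' b');
  mq_mul_homl : forall b, is_qhom (fun a => mq_mul a b);
  mq_mul_homr : forall d, is_qhom (mq_mul (mq_iota d));
  mq_iota_emb : order_embedding mq_iota;
  mq_iota_mul : forall c d, mq_iota (pm_mul c d) = mq_mul (mq_iota c) (mq_iota d);
  mq_iota_one : mq_iota (pm_one mq_d) = mq_one
}.

Record is_module s (A : mult_quantale s) (Q : quantale s) (ast : A -> Q -> Q) : Prop :=
  IsModule {
  mod_mono : forall a a' x x', ple a a' -> ple x x' -> ple (ast a x) (ast a' x');
  mod_mul : forall a b x, ast (mq_mul a b) x = ast a (ast b x);
  mod_one : forall x, ast (mq_one A) x = x;
  mod_plus : forall a b x, ast (plus a b) x = plus (ast a x) (ast b x);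
  mod_zero : forall x, ast (zero A) x = zero Q;
  mod_join : forall (S : jset s A) x,
    ast (join S) x = join (jimage (fun a => ast a x) S);
  mod_iota : forall d : mq_d A, is_qhom (ast (mq_iota d))
}.

Record is_act s (M : pomonoid) (L : quantale s) (ast : M -> L -> L) : Prop := IsAct {
  act_mono : forall a a' x x', ple a a' -> ple x x' -> ple (ast a x) (ast a' x');
  act_mul : forall a b x, ast (pm_mul a b) x = ast a (ast b x);
  act_one : forall x, ast (pm_one M) x = x;
  act_endo : forall a, is_qhom (ast a)
}.

Record category := Category {
  obj :> Type;
  hom : obj -> obj -> Type;
  idm : forall x, hom x x;
  comp : forall x y z, hom y z -> hom x y -> hom x z;
  compA : forall x y z w (f : hom x y) (g : hom y z) (h : hom z w),
    comp h (comp g f) = comp (comp h g) f;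
  comp1l : forall x y (f : hom x y), comp (idm y) f = f;
  comp1r : forall x y (f : hom x y), comp f (idm x) = f
}.

Record functor (C D : category) := Functor {
  fobj :> C -> D;
  fmap : forall x y : C, hom x y -> hom (fobj x) (fobj y);
  fmap_id : forall x : C, fmap (idm x) = idm (fobj x);
  fmap_comp : forall (x y z : C) (g : hom y z) (f : hom x y),
    fmap (comp g f) = comp (fmap g) (fmap f)
}.

Definition idF (C : category) : functor C C :=
  @Functor C C (fun x => x) (fun _ _ f => f)
    (fun _ => eq_refl) (fun _ _ _ _ _ => eq_refl).

Definition compF (C D E : category) (G : functor D E) (F : functor C D) : functor C E.
Proof.
refine (@Functor C E (fun x => G (F x)) (fun x y f => fmap G (fmap F f)) _ _).
- intros x. rewrite !fmap_id. reflexivity.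
- intros x y z g f. rewrite !fmap_comp. reflexivity.
Defined.

(* Strict isomorphism of categories: equality of functors is Leibniz equality. *)
Definition is_cat_iso (C D : category) (F : functor C D) : Prop :=
  exists G : functor D C, compF G F = idF C /\ compF F G = idF D.

Record kmodule s (K : quantale s -> Prop) (A : mult_quantale s) := KModule {
  km_q :> quantale s;
  km_in : K km_q;
  km_ast : A -> km_q -> km_q;
  km_mod : is_module km_ast
}.

Record mod_hom s (K : quantale s -> Prop) (A : mult_quantale s) (P Q : kmodule K A) :=
  ModHom {
  mh_fun :> P -> Q;
  mh_qhom : is_qhom mh_fun;
  mh_ast : forall a x, mh_fun (km_ast a x) = km_ast a (mh_fun x)
}.

Lemma mod_hom_eq s (K : quantale s -> Prop) (A : mult_quantale s)
  (P Q : kmodule K A) (f g : mod_hom P Q) : mh_fun f = mh_fun g -> f = g.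
Proof.
destruct f as [f f1 f2], g as [g g1 g2]; simpl; intros ->.
f_equal; apply proof_irrelevance.
Qed.

Definition mod_id s (K : quantale s -> Prop) (A : mult_quantale s) (P : kmodule K A) :
  mod_hom P P := @ModHom s K A P P (fun x => x) (is_qhom_id P) (fun _ _ => eq_refl).

Definition mod_comp s (K : quantale s -> Prop) (A : mult_quantale s)
  (P Q R : kmodule K A) (g : mod_hom Q R) (f : mod_hom P Q) : mod_hom P R.
Proof.
refine (@ModHom s K A P R (fun x => g (f x)) (is_qhom_comp (mh_qhom f) (mh_qhom g)) _).
intros a x. rewrite !mh_ast. reflexivity.
Defined.

Definition ModCat s (K : quantale s -> Prop) (A : mult_quantale s) : category.
Proof.
refine (@Category (kmodule K A) (@mod_hom s K A) (@mod_id s K A) (@mod_comp s K A) _ _ _);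
  intros; apply mod_hom_eq; reflexivity.
Defined.

Record kact s (K : quantale s -> Prop) (M : pomonoid) := KAct {
  ka_q :> quantale s;
  ka_in : K ka_q;
  ka_ast : M -> ka_q -> ka_q;
  ka_act : is_act ka_ast
}.

Record act_hom s (K : quantale s -> Prop) (M : pomonoid) (P Q : kact K M) := ActHom {
  ah_fun :> P -> Q;
  ah_qhom : is_qhom ah_fun;
  ah_ast : forall a x, ah_fun (ka_ast a x) = ka_ast a (ah_fun x)
}.

Lemma act_hom_eq s (K : quantale s -> Prop) (M : pomonoid)
  (P Q : kact K M) (f g : act_hom P Q) : ah_fun f = ah_fun g -> f = g.
Proof.
destruct f as [f f1 f2], g as [g g1 g2]; simpl; intros ->.
f_equal; apply proof_irrelevance.
Qed.

Definition act_id s (K : quantale s -> Prop) (M : pomonoid) (P : kact K M) :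
  act_hom P P := @ActHom s K M P P (fun x => x) (is_qhom_id P) (fun _ _ => eq_refl).

Definition act_comp s (K : quantale s -> Prop) (M : pomonoid)
  (P Q R : kact K M) (g : act_hom Q R) (f : act_hom P Q) : act_hom P R.
Proof.
refine (@ActHom s K M P R (fun x => g (f x)) (is_qhom_comp (ah_qhom f) (ah_qhom g)) _).
intros a x. rewrite !ah_ast. reflexivity.
Defined.

Definition ActCat s (K : quantale s -> Prop) (M : pomonoid) : category.
Proof.
refine (@Category (kact K M) (@act_hom s K M) (@act_id s K M) (@act_comp s K M) _ _ _);
  intros; apply act_hom_eq; reflexivity.
Defined.

Lemma forget_is_act s (A : mult_quantale s) (Q : quantale s) (ast : A -> Q -> Q) :
  is_module ast -> is_act (fun (d : mq_d A) x => ast (mq_iota d) x).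
Proof.
intros H. split.
- intros a a' x x' Ha Hx. apply (mod_mono H); [apply mq_iota_emb|]; assumption.
- intros a b x. rewrite mq_iota_mul. apply (mod_mul H).
- intros x. rewrite mq_iota_one. apply (mod_one H).
- apply (mod_iota H).
Qed.

Definition forget_obj s (K : quantale s -> Prop) (A : mult_quantale s)
    (P : kmodule K A) : kact K (mq_d A) :=
  KAct (km_in P) (forget_is_act (km_mod P)).

Definition forget_hom s (K : quantale s -> Prop) (A : mult_quantale s)
    (P Q : kmodule K A) (f : mod_hom P Q) : act_hom (forget_obj P) (forget_obj Q) :=
  @ActHom s K (mq_d A) (forget_obj P) (forget_obj Q) (mh_fun f) (mh_qhom f)
    (fun d x => mh_ast f (mq_iota d) x).

Definition forgetful s (K : quantale s -> Prop) (A : mult_quantale s) :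
  functor (ModCat K A) (ActCat K (mq_d A)).
Proof.
refine (@Functor (ModCat K A) (ActCat K (mq_d A))
          (@forget_obj s K A) (@forget_hom s K A) _ _);
  intros; apply act_hom_eq; reflexivity.
Defined.

(* Any choice of a K-free quantale over X, given with its unit. *)
Record free_quantale s (K : quantale s -> Prop) (X : poset) := FreeQuantale {
  fq_q :> quantale s;
  fq_in : K fq_q;
  eta : X -> fq_q;
  eta_mono : order_preserving eta;
  fq_univ : forall Q : quantale s, K Q -> forall g : X -> Q, order_preserving g ->
    exists! h : fq_q -> Q, is_qhom h /\ forall x, h (eta x) = g x
}.

Arguments eta {s K X} f.

Record is_free_mul s (K : quantale s -> Prop) (M : pomonoid)
    (F : free_quantale K M) (mul : F -> F -> F) : Prop := IsFreeMul {
  fm_left : forall (V : Type) (t : qterm s V) (a : V -> F) (b : F),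
    mul (qeval t a) b = qeval t (fun v => mul (a v) b);
  fm_right : forall (V : Type) (t : qterm s V) (a : M) (b : V -> F),
    mul (eta F a) (qeval t b) = qeval t (fun v => mul (eta F a) (b v));
  fm_eta : forall a c : M, mul (eta F a) (eta F c) = eta F (pm_mul a c)
}.

Lemma is_qhom_mono s (P Q : quantale s) (f : P -> Q) : is_qhom f -> order_preserving f.
Proof.
intros Hf x y xy.
assert (adm : admissible s (fun z : P => z = x \/ z = y)).
{ destruct s; simpl; [trivial|]. exists x. auto. }
pose (S := JSet adm).
assert (E : join S = y).
{ apply join_unique. split.
  - intros z [-> | ->]; [assumption | apply ple_refl].
  - intros u Hu. apply Hu. simpl. auto. }
rewrite <- E, (qhom_join Hf). apply (join_lub (jimage f S)). exists x. simpl. auto.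
Qed.

Lemma qeval_hom s (P Q : quantale s) (f : P -> Q) :
  is_qhom f <->
  (forall (V : Type) (t : qterm s V) (a : V -> P),
     f (qeval t a) = qeval t (fun v => f (a v))).
Proof.
split.
- intros Hf V t a. unfold qeval. rewrite (qhom_join Hf).
  apply join_jimage_comp. intros m.
  induction m as [v | m1 IH1 m2 IH2 | ]; simpl.
  + reflexivity.
  + rewrite (qhom_plus Hf), IH1, IH2. reflexivity.
  + apply (qhom_zero Hf).
- intros H.
  assert (adm1 : forall V (m : mterm V), admissible s (fun z => z = m)).
  { intros V m. destruct s; simpl; eauto. }
  assert (ev1 : forall (R : quantale s) V (m : mterm V) (a : V -> R),
            qeval (JSet (adm1 V m)) a = meval a m).
  { intros R V m a. apply join_unique. split.
    - intros x [z [-> ->]]. apply ple_refl.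
    - intros u Hu. apply Hu. exists m. simpl. auto. }
  split.
  + intros S.
    assert (E : forall (R : quantale s) (a : P -> R),
               qeval (jimage (@MVar P) S) a = join (jimage a S)).
    { intros R a. apply join_jimage_comp. reflexivity. }
    specialize (H P (jimage (@MVar P) S) (fun x => x)). rewrite !E in H.
    transitivity (f (join (jimage (fun x => x) S))); [|exact H].
    f_equal. apply (qhom_join (is_qhom_id P)).
  + intros x y.
    specialize (H bool (JSet (adm1 _ (MPlus (MVar true) (MVar false))))
                  (fun b : bool => if b then x else y)).
    rewrite !ev1 in H. exact H.
  + specialize (H bool (JSet (adm1 _ MZero)) (fun b : bool => zero P)).
    rewrite !ev1 in H. exact H.
Qed.

Lemma fq_ext s (K : quantale s -> Prop) (X : poset) (F : free_quantale K X)
    (Q : quantale s) (KQ : K Q) (f g : F -> Q) :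
  is_qhom f -> is_qhom g -> (forall x, f (eta F x) = g (eta F x)) ->
  forall a, f a = g a.
Proof.
intros Hf Hg E a.
destruct (fq_univ F KQ (g := fun x => f (eta F x))) as [h [_ U]].
- intros x y xy. apply (is_qhom_mono Hf), eta_mono, xy.
- rewrite <- (U f (conj Hf (fun _ => eq_refl))).
  rewrite <- (U g (conj Hg (fun x => eq_sym (E x)))). reflexivity.
Qed.

Lemma fq_ind s (K : quantale s -> Prop) (HK : prevariety K) (X : poset)
    (F : free_quantale K X) (B : F -> Prop) :
  subclosed B -> (forall x, B (eta F x)) -> forall a, B a.
Proof.
intros HB Heta a.
destruct (fq_univ F (prevar_sub HK HB (fq_in F))
            (g := fun x => exist B (eta F x) (Heta x))) as [h [[Hh Eh] _]].
- intros x y xy. apply (eta_mono F), xy.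
- assert (Hp : is_qhom (P := subquantale HB) (Q := F)
                 (fun x : sub_poset B => proj1_sig x)) by (split; reflexivity).
  rewrite <- (fq_ext (fq_in F) (is_qhom_comp Hh Hp) (is_qhom_id F)).
  + apply proj2_sig.
  + intros x. rewrite Eh. reflexivity.
Qed.

Lemma le_hom_subclosed s (P Q : quantale s) (f g : P -> Q) :
  is_qhom f -> is_qhom g -> subclosed (fun x => ple (f x) (g x)).
Proof.
intros Hf Hg. split.
- intros S HS. rewrite (qhom_join Hf), (qhom_join Hg).
  apply (join_lub (jimage f S)). intros z [x [Sx ->]].
  apply (ple_trans (HS x Sx)). apply (join_lub (jimage g S)). exists x. auto.
- intros x y Hx Hy. rewrite (qhom_plus Hf), (qhom_plus Hg). apply plus_mono; assumption.
- rewrite (qhom_zero Hf), (qhom_zero Hg). apply ple_refl.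
Qed.

Section FreeMul.
Context (s : setting) (K : quantale s -> Prop) (HK : prevariety K) (M : pomonoid)
  (F : free_quantale K M).

Lemma fm_homl mul (H : is_free_mul (F := F) mul) b : is_qhom (fun a => mul a b).
Proof. apply qeval_hom. intros. apply (fm_left H). Qed.

Lemma fm_homr mul (H : is_free_mul (F := F) mul) a : is_qhom (mul (eta F a)).
Proof. apply qeval_hom. intros. apply (fm_right H). Qed.

Lemma fm_mulA mul (H : is_free_mul (F := F) mul) a b c :
  mul a (mul b c) = mul (mul a b) c.
Proof.
apply (fq_ext (fq_in F) (f := fun a => mul a (mul b c)) (g := fun a => mul (mul a b) c)).
- apply (fm_homl H).
- apply (is_qhom_comp (fm_homl H b) (fm_homl H c)).
- intros m.
  apply (fq_ext (fq_in F) (f := fun b => mul (eta F m) (mul b c))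
           (g := fun b => mul (mul (eta F m) b) c)).
  + apply (is_qhom_comp (fm_homl H c) (fm_homr H m)).
  + apply (is_qhom_comp (fm_homr H m) (fm_homl H c)).
  + intros n.
    apply (fq_ext (fq_in F) (f := fun c => mul (eta F m) (mul (eta F n) c))
             (g := fun c => mul (mul (eta F m) (eta F n)) c)).
    * apply (is_qhom_comp (fm_homr H n) (fm_homr H m)).
    * rewrite (fm_eta H). apply (fm_homr H).
    * intros k. rewrite !(fm_eta H), pm_mulA. reflexivity.
Qed.

Lemma fm_mul1l mul (H : is_free_mul (F := F) mul) a : mul (eta F (pm_one M)) a = a.
Proof.
apply (fq_ext (fq_in F) (f := mul (eta F (pm_one M))) (g := fun a => a)).
- apply (fm_homr H).
- apply is_qhom_id.
- intros m. rewrite (fm_eta H), pm_mul1l. reflexivity.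
Qed.

Lemma fm_mul1r mul (H : is_free_mul (F := F) mul) a : mul a (eta F (pm_one M)) = a.
Proof.
apply (fq_ext (fq_in F) (f := fun a => mul a (eta F (pm_one M))) (g := fun a => a)).
- apply (fm_homl H).
- apply is_qhom_id.
- intros m. rewrite (fm_eta H), pm_mul1r. reflexivity.
Qed.

Lemma fm_mul_mono mul (H : is_free_mul (F := F) mul) a a' b b' :
  ple a a' -> ple b b' -> ple (mul a b) (mul a' b').
Proof.
intros Ha Hb. apply (ple_trans (is_qhom_mono (fm_homl H b) Ha)).
apply (fq_ind HK (B := fun a => ple (mul a b) (mul a b'))).
- apply (le_hom_subclosed (fm_homl H b) (fm_homl H b')).
- intros m. apply (is_qhom_mono (fm_homr H m) Hb).
Qed.

(* is_free_mul is a definite description: it singles out the multiplication of F_K(M). *)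
Lemma free_mul_exists_unique : exists! mul : F -> F -> F, is_free_mul mul.
Proof.
assert (mono1 : forall m : M, order_preserving (fun n => eta F (pm_mul m n))).
{ intros m x y xy. apply eta_mono, pm_mul_mono; [apply ple_refl | exact xy]. }
pose (l := fun m => proj1_sig (constructive_indefinite_description _
                      (fq_univ F (fq_in F) (mono1 m)))).
assert (Hl : forall m, is_qhom (l m) /\ forall n, l m (eta F n) = eta F (pm_mul m n)).
{ intros m. apply (proj1 (proj2_sig (constructive_indefinite_description _
                     (fq_univ F (fq_in F) (mono1 m))))). }
assert (mono2 : forall b : F, order_preserving (fun m => l m b)).
{ intros b x y xy. apply (fq_ind HK (B := fun b => ple (l x b) (l y b))).
  - apply le_hom_subclosed; apply Hl.
  - intros n. rewrite !(proj2 (Hl _)).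
    apply eta_mono, pm_mul_mono; [exact xy | apply ple_refl]. }
pose (r := fun b => proj1_sig (constructive_indefinite_description _
                      (fq_univ F (fq_in F) (mono2 b)))).
assert (Hr : forall b, is_qhom (r b) /\ forall m, r b (eta F m) = l m b).
{ intros b. apply (proj1 (proj2_sig (constructive_indefinite_description _
                     (fq_univ F (fq_in F) (mono2 b))))). }
exists (fun a b => r b a). split.
- split.
  + intros V t a b. apply (proj1 (qeval_hom (r b)) (proj1 (Hr b))).
  + intros V t a b. rewrite (proj2 (Hr _)).
    rewrite (proj1 (qeval_hom (l a)) (proj1 (Hl a))).
    f_equal. apply functional_extensionality. intros v.
    rewrite (proj2 (Hr _)). reflexivity.
  + intros a c. rewrite (proj2 (Hr _)). apply Hl.
- intros mul H. apply functional_extensionality. intros a.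
  apply functional_extensionality. intros b.
  apply (fq_ext (fq_in F) (f := r b) (g := fun a => mul a b)).
  + apply Hr.
  + apply (fm_homl H).
  + intros m. rewrite (proj2 (Hr _)).
    apply (fq_ext (fq_in F) (f := l m) (g := mul (eta F m))).
    * apply Hl.
    * apply (fm_homr H).
    * intros n. rewrite (proj2 (Hl _)), (fm_eta H). reflexivity.
Qed.

End FreeMul.

(* F_K(M) = (M, F_K(M), eta_M), with unit eta_M(1). *)
Definition free_mult_quantale s (K : quantale s -> Prop) (HK : prevariety K)
    (M : pomonoid) (F : free_quantale K M) (mul : F -> F -> F)
    (Hmul : is_free_mul mul) (Heta : order_embedding (eta F)) : mult_quantale s :=
  @MultQuantale s M F mul (eta F (pm_one M)) (eta F)
    (fm_mulA Hmul) (fm_mul1l Hmul) (fm_mul1r Hmul) (fm_mul_mono HK Hmul)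
    (fm_homl Hmul) (fm_homr Hmul) Heta
    (fun c d => eq_sym (fm_eta Hmul c d)) eq_refl.

(* Main.v *)
From Stdlib Require Import FunctionalExtensionality ProofIrrelevance ClassicalEpsilon.
Require Import Defs.

(** A functor that is bijective on objects and on hom-sets is an isomorphism of
    categories, so the claim splits into two: every act in [K] has exactly one
    expansion to a module, and every act morphism between modules is a module
    morphism.  For fixed [x], a module action [a * x] is a homomorphism in [a],
    and it restricts to the monotone map [m |-> star m x] along [eta].
    Freeness therefore leaves one candidate for the expansion, namely the
    homomorphic extension of that map.  The remaining identities and
    inequalities, those of the module laws and those for morphisms, compare
    homomorphisms out of [F], so it suffices to check them on the generators
    [eta m], where they are act laws. *)

Set Implicit Arguments.
Unset Strict Implicit.
Unset Printing Implicit Defensive.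

(* [constructive_definite_description] lives in a universe too small for the
   objects of a [category]. *)
Section UniqueChoice.
Variables (A : Type) (P : A -> Prop) (HP : exists! x, P x).

Definition unique_choice : A := proj1_sig (constructive_indefinite_description _ HP).

Lemma unique_choice_spec : P unique_choice.
Proof. exact (proj1 (proj2_sig (constructive_indefinite_description _ HP))). Qed.

Lemma unique_choice_eq x : P x -> unique_choice = x.
Proof. exact (proj2 (proj2_sig (constructive_indefinite_description _ HP)) x). Qed.

End UniqueChoice.

Definition hom_cast (C : category) (x x' y y' : C) (ex : x = x') (ey : y = y')
    (f : hom x y) : hom x' y' :=
  match ex in _ = u, ey in _ = v return hom u v with eq_refl, eq_refl => f end.

Lemma hom_cast_id (C : category) (x x' : C) (e : x = x') :
  hom_cast e e (idm x) = idm x'.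
Proof. destruct e. reflexivity. Qed.

Lemma hom_cast_comp (C : category) (x x' y y' z z' : C)
    (ex : x = x') (ey : y = y') (ez : z = z') (g : hom y z) (f : hom x y) :
  hom_cast ex ez (comp g f) = comp (hom_cast ey ez g) (hom_cast ex ey f).
Proof. destruct ex, ey, ez. reflexivity. Qed.

Lemma hom_castK (C : category) (x x' y y' : C) (ex : x = x') (ey : y = y')
    (ex' : x' = x) (ey' : y' = y) (f : hom x y) :
  hom_cast ex' ey' (hom_cast ex ey f) = f.
Proof.
destruct ex, ey.
rewrite (proof_irrelevance _ ex' eq_refl), (proof_irrelevance _ ey' eq_refl).
reflexivity.
Qed.

Lemma fmap_hom_cast (C D : category) (F : functor C D) (x x' y y' : C)
    (ex : x = x') (ey : y = y') (f : hom x y) :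
  fmap F (hom_cast ex ey f) =
  hom_cast (f_equal (fobj F) ex) (f_equal (fobj F) ey) (fmap F f).
Proof. destruct ex, ey. reflexivity. Qed.

Lemma functor_eq (C D : category) (F G : functor C D) (E : forall x, F x = G x) :
  (forall (x y : C) (f : hom x y), hom_cast (E x) (E y) (fmap F f) = fmap G f) ->
  F = G.
Proof.
destruct F as [Fobj Fmap Fid Fcomp], G as [Gobj Gmap Gid Gcomp]; simpl in *.
intros Emap.
assert (Eobj : Fobj = Gobj) by (apply functional_extensionality, E).
subst Gobj.
assert (Fmap = Gmap) as <-.
{ do 3 (apply functional_extensionality_dep; intros ?).
  rewrite <- Emap, !(proof_irrelevance _ (E _) eq_refl). reflexivity. }
f_equal; apply proof_irrelevance.
Qed.

Definition fully_faithful (C D : category) (F : functor C D) : Prop :=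
  forall (x y : C) (g : hom (F x) (F y)), exists! f : hom x y, fmap F f = g.

Definition bijective_on_objects (C D : category) (F : functor C D) : Prop :=
  forall d : D, exists! c : C, F c = d.

Section InverseFunctor.
Variables (C D : category) (F : functor C D).
Hypotheses (Fff : fully_faithful F) (Fbij : bijective_on_objects F).

Definition inverse_obj (d : D) : C := unique_choice (Fbij d).

Lemma inverse_objK d : F (inverse_obj d) = d.
Proof. apply (unique_choice_spec (Fbij d)). Qed.

Lemma fobjK c : inverse_obj (F c) = c.
Proof. apply unique_choice_eq. reflexivity. Qed.

Definition fmap_inv (x y : C) (g : hom (F x) (F y)) : hom x y := unique_choice (Fff g).

Lemma fmap_invK (x y : C) (g : hom (F x) (F y)) : fmap F (fmap_inv g) = g.
Proof. apply (unique_choice_spec (Fff g)). Qed.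

Lemma fmapK (x y : C) (f : hom x y) : fmap_inv (fmap F f) = f.
Proof. apply unique_choice_eq. reflexivity. Qed.

Lemma fmap_inj (x y : C) (f f' : hom x y) : fmap F f = fmap F f' -> f = f'.
Proof. intros E. rewrite <- (fmapK f), E. apply fmapK. Qed.

Definition inverse_fmap (d d' : D) (g : hom d d') :
    hom (inverse_obj d) (inverse_obj d') :=
  fmap_inv (hom_cast (eq_sym (inverse_objK d)) (eq_sym (inverse_objK d')) g).

Definition inverse_functor : functor D C.
Proof.
refine (@Functor D C inverse_obj inverse_fmap _ _).
- intros d. apply fmap_inj. unfold inverse_fmap.
  rewrite fmap_invK, fmap_id. apply hom_cast_id.
- intros d d' d'' g f. apply fmap_inj. unfold inverse_fmap.
  rewrite fmap_comp, !fmap_invK. apply hom_cast_comp.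
Defined.

Lemma fully_faithful_bijective_cat_iso : is_cat_iso F.
Proof.
exists inverse_functor. split.
- apply (functor_eq (F := compF inverse_functor F) (G := idF C) (E := fobjK)).
  intros x y f. apply fmap_inj. simpl. unfold inverse_fmap.
  rewrite fmap_hom_cast, fmap_invK. apply hom_castK.
- apply (functor_eq (F := compF F inverse_functor) (G := idF D) (E := inverse_objK)).
  intros x y f. simpl. unfold inverse_fmap.
  rewrite fmap_invK. apply hom_castK.
Qed.

End InverseFunctor.

Section FreeQuantale.
Variables (s : setting) (K : quantale s -> Prop) (X : poset) (F : free_quantale K X).
Variable Q : quantale s.

Lemma fq_le (HK : prevariety K) (f g : F -> Q) :
  is_qhom f -> is_qhom g -> (forall x, ple (f (eta F x)) (g (eta F x))) ->
  forall a, ple (f a) (g a).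
Proof.
intros Hf Hg. apply (fq_ind HK (B := fun a => ple (f a) (g a))).
apply (le_hom_subclosed Hf Hg).
Qed.

Variables (KQ : K Q) (g : X -> Q) (Hg : order_preserving g).

Definition free_lift : F -> Q := unique_choice (fq_univ F KQ Hg).

Lemma free_lift_qhom : is_qhom free_lift.
Proof. apply (unique_choice_spec (fq_univ F KQ Hg)). Qed.

Lemma free_lift_eta x : free_lift (eta F x) = g x.
Proof. apply (unique_choice_spec (fq_univ F KQ Hg)). Qed.

End FreeQuantale.

Lemma module_qhom s (A : mult_quantale s) (Q : quantale s) (ast : A -> Q -> Q) :
  is_module ast -> forall x, is_qhom (fun a => ast a x).
Proof.
intros H x. split.
- intros S. apply (mod_join H).
- intros a b. apply (mod_plus H).
- apply (mod_zero H).
Qed.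

Lemma kmodule_eq s (K : quantale s -> Prop) (A : mult_quantale s) (P : kmodule K A)
    (ast : A -> P -> P) (Hast : is_module ast) :
  ast = km_ast (k := P) -> KModule (km_in P) Hast = P.
Proof.
destruct P as [Q KQ astQ HQ]; simpl in *. intros ->.
f_equal. apply proof_irrelevance.
Qed.

Lemma kact_eq s (K : quantale s -> Prop) (M : pomonoid) (P : kact K M)
    (star : M -> P -> P) (Hstar : is_act star) :
  star = ka_ast (k := P) -> KAct (ka_in P) Hstar = P.
Proof.
destruct P as [L KL starL HL]; simpl in *. intros ->.
f_equal. apply proof_irrelevance.
Qed.

Lemma act_orbit_mono s (M : pomonoid) (L : quantale s) (star : M -> L -> L) :
  is_act star -> forall x, order_preserving (fun m => star m x).
Proof. intros H x m n mn. apply (act_mono H mn), ple_refl. Qed.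

Section ActExpansion.
Variables (s : setting) (K : quantale s -> Prop) (M : pomonoid)
  (F : free_quantale K M).
Variables (L : quantale s) (KL : K L) (star : M -> L -> L) (Hstar : is_act star).

Definition act_expansion (a : F) (x : L) : L :=
  free_lift KL (act_orbit_mono Hstar x) a.

Lemma act_expansion_qhom x : is_qhom (fun a => act_expansion a x).
Proof. apply free_lift_qhom. Qed.

Lemma act_expansion_eta m x : act_expansion (eta F m) x = star m x.
Proof. apply (free_lift_eta F KL). Qed.

Lemma act_expansion_eta_qhom m : is_qhom (act_expansion (eta F m)).
Proof.
replace (act_expansion (eta F m)) with (star m).
- apply (act_endo Hstar).
- apply functional_extensionality. intros x. symmetry. apply act_expansion_eta.
Qed.

Lemma act_expansion_mono (HK : prevariety K) a a' x x' :
  ple a a' -> ple x x' -> ple (act_expansion a x) (act_expansion a' x').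
Proof.
intros Ha Hx. apply (ple_trans (is_qhom_mono (act_expansion_qhom x) Ha)).
apply (fq_le HK (act_expansion_qhom x) (act_expansion_qhom x')).
intros m. apply (is_qhom_mono (act_expansion_eta_qhom m) Hx).
Qed.

Variables (mul : F -> F -> F) (Hmul : is_free_mul mul).

Lemma act_expansion_mul_eta m b x :
  act_expansion (mul (eta F m) b) x = star m (act_expansion b x).
Proof.
apply (fq_ext KL (f := fun b => act_expansion (mul (eta F m) b) x)
         (g := fun b => star m (act_expansion b x))).
- apply (is_qhom_comp (fm_homr Hmul m) (act_expansion_qhom x)).
- apply (is_qhom_comp (act_expansion_qhom x) (act_endo Hstar m)).
- intros n. rewrite (fm_eta Hmul), !act_expansion_eta. apply (act_mul Hstar).
Qed.

Lemma act_expansion_mul a b x :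
  act_expansion (mul a b) x = act_expansion a (act_expansion b x).
Proof.
apply (fq_ext KL (f := fun a => act_expansion (mul a b) x)
         (g := fun a => act_expansion a (act_expansion b x))).
- apply (is_qhom_comp (fm_homl Hmul b) (act_expansion_qhom x)).
- apply act_expansion_qhom.
- intros m. rewrite act_expansion_eta. apply act_expansion_mul_eta.
Qed.

Lemma act_expansion_module (HK : prevariety K) (Heta : order_embedding (eta F)) :
  is_module (A := free_mult_quantale HK Hmul Heta) act_expansion.
Proof.
split.
- apply (act_expansion_mono HK).
- apply act_expansion_mul.
- intros x. simpl. rewrite act_expansion_eta. apply (act_one Hstar).
- intros a b x. apply (qhom_plus (act_expansion_qhom x)).
- intros x. apply (qhom_zero (act_expansion_qhom x)).
- intros S x. apply (qhom_join (act_expansion_qhom x)).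
- apply act_expansion_eta_qhom.
Qed.

End ActExpansion.

Section FreeModules.
Variables (s : setting) (K : quantale s -> Prop) (HK : prevariety K) (M : pomonoid)
  (F : free_quantale K M) (mul : F -> F -> F) (Hmul : is_free_mul mul)
  (Heta : order_embedding (eta F)).
Let FM := free_mult_quantale HK Hmul Heta.

Lemma act_hom_is_mod_hom (P Q : quantale s) (KQ : K Q)
    (astP : F -> P -> P) (astQ : F -> Q -> Q) (f : P -> Q) :
  is_module (A := FM) astP -> is_module (A := FM) astQ -> is_qhom f ->
  (forall m x, f (astP (eta F m) x) = astQ (eta F m) (f x)) ->
  forall a x, f (astP a x) = astQ a (f x).
Proof.
intros HP HQ Hf E a x.
apply (fq_ext KQ (f := fun a => f (astP a x)) (g := fun a => astQ a (f x))).
- apply (is_qhom_comp (module_qhom HP x) Hf).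
- apply (module_qhom HQ).
- intros m. apply E.
Qed.

Lemma module_ext (L : quantale s) (KL : K L) (ast ast' : F -> L -> L) :
  is_module (A := FM) ast -> is_module (A := FM) ast' ->
  (forall m x, ast (eta F m) x = ast' (eta F m) x) -> ast = ast'.
Proof.
intros H H' E. do 2 (apply functional_extensionality; intros ?).
apply (act_hom_is_mod_hom KL H H' (is_qhom_id L) E).
Qed.

Lemma act_unique_expansion (L : quantale s) (star : M -> L -> L) :
  K L -> is_act star ->
  exists! ast : F -> L -> L,
    is_module (A := FM) ast /\ forall m x, ast (eta F m) x = star m x.
Proof.
intros KL Hstar. exists (act_expansion KL Hstar). split.
- split; [apply act_expansion_module | apply act_expansion_eta].
- intros ast [Hast E].
  apply (module_ext KL (act_expansion_module KL Hstar Hmul HK Heta) Hast).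
  intros m x. rewrite E. apply act_expansion_eta.
Qed.

Lemma forgetful_fully_faithful : fully_faithful (forgetful K FM).
Proof.
intros P Q g.
exists (ModHom (ah_qhom g)
          (act_hom_is_mod_hom (km_in Q) (km_mod P) (km_mod Q) (ah_qhom g) (ah_ast g))).
split.
- apply act_hom_eq. reflexivity.
- intros f <-. apply mod_hom_eq. reflexivity.
Qed.

Lemma forgetful_bijective_on_objects : bijective_on_objects (forgetful K FM).
Proof.
intros P.
destruct (act_unique_expansion (ka_in P) (ka_act P)) as [ast [[Hast E] U]].
exists (KModule (ka_in P) Hast). split.
- apply kact_eq. do 2 (apply functional_extensionality; intros ?). apply E.
- intros Q <-. apply kmodule_eq, U. split; [apply km_mod | reflexivity].
Qed.

End FreeModules.

Theorem theorem4p2 (s : setting) (K : quantale s -> Prop) (HK : prevariety K)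
    (M : pomonoid) (F : free_quantale K M)
    (mul : F -> F -> F) (Hmul : is_free_mul mul)
    (Heta : order_embedding (eta F)) :
  is_cat_iso (forgetful K (free_mult_quantale HK Hmul Heta)) /\
  (forall (L : quantale s) (star : M -> L -> L), K L -> is_act star ->
     exists! ast : F -> L -> L,
       is_module (A := free_mult_quantale HK Hmul Heta) ast /\
       (forall (a : M) (x : L), ast (eta F a) x = star a x)).
Proof.
split.
- apply fully_faithful_bijective_cat_iso.
  + apply forgetful_fully_faithful.
  + apply forgetful_bijective_on_objects.
- apply act_unique_expansion.
Qed.
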